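(* Let $K\ge2$ be an integer, let $V:\mathbb{R}\to\mathbb{R}$ be a double-well potential satisfying the conditions in the context, and assume that the associated infinite swapping process (for $\boldsymbol{\alpha}\in\Delta$) satisfies a large deviation principle that is uniform with respect to initial conditions. Let $A\subset D\cap(-\infty,0]$ be a nonempty closed set with $x_L\notin A$, and let $V(A)=\inf_{x\in A}V(x)$. (i) If $V(A)\ge h_L$, then $$\sup_{\boldsymbol{\alpha}\in\Delta}\big[\hat r_1(\boldsymbol{\alpha})\wedge\hat r_3(\boldsymbol{\alpha})\big]=2V(A)-(1/2)^{K-1}V(A),$$ with the optimal $\boldsymbol{\alpha}^*=\big(1,1/2,\dots,(1/2)^{K-2},(1/2)^{K-1}\big)\in\Delta$. (ii) If $V(A)\le h_L$, then $$\sup_{\boldsymbol{\alpha}\in\Delta}\big[\hat r_1(\boldsymbol{\alpha})\wedge\hat r_3(\boldsymbol{\alpha})\big]=2V(A)-(1/2)^{K-2}\Big(\frac{h_L}{V(A)+h_L}\Big)V(A),$$ with the optimal $\boldsymbol{\alpha}^*=\Big(1,1/2,\dots,(1/2)^{K-2},\frac{V(A)}{V(A)+h_L}(1/2)^{K-2}\Big)\in\Delta$. Here ''optimal'' means that the supremum is attained at $\boldsymbol{\alpha}^*$.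
   Context: Conditions on $V$. $V$ is a bounded $C^2$ function, defined on a compact interval $D\subset\mathbb{R}$ and extended periodically to $\mathbb{R}$ as a $C^2$ function. On $D$, $V$ has only two local minima, at $x_L$ and $x_R$, with $V(x_L)<V(x_R)$, and only one local maximum, at $0\in(x_L,x_R)$. Moreover $V(x_L)=0$, $V(0)=h_L$, $V(x_R)=h_L-h_R>0$, and $\inf_{x\in\partial D}V(x)>h_L$. Notation. $\Sigma_K$ is the set of permutations of $\{1,\dots,K\}$; $\Delta=\{(\alpha_1,\dots,\alpha_K)\in\mathbb{R}^K:1=\alpha_1\ge\alpha_2\ge\cdots\ge\alpha_K>0\}$; $a\wedge b=\min(a,b)$. For $\boldsymbol{\alpha}\in\Delta$, $$\hat r_1(\boldsymbol{\alpha})=\inf_{\boldsymbol{x}\in A\times\mathbb{R}^{K-1}}\Big[2\sum_{\ell=1}^K\alpha_\ell V(x_\ell)-\min_{\sigma\in\Sigma_K}\Big\{\sum_{\ell=1}^K\alpha_\ell V(x_{\sigma(\ell)})\Big\}\Big],\qquad \hat r_3(\boldsymbol{\alpha})=2V(A)-\alpha_K h_L .$$ Infinite swapping process. For $\boldsymbol{\alpha}\in\Delta$, with $\boldsymbol{x}_\sigma=(x_{\sigma(1)},\dots,x_{\sigma(K)})$, let $$w^{\varepsilon}(\boldsymbol{x};\boldsymbol{\alpha})=\frac{\exp[-\frac1\varepsilon\sum_{\ell}\alpha_\ell V(x_\ell)]}{\sum_{\sigma\in\Sigma_K}\exp[-\frac1\varepsilon\sum_{\ell}\alpha_\ell V(x_{\sigma(\ell)})]},\qquad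 \rho^\varepsilon_{ij}(\boldsymbol{x};\boldsymbol{\alpha})=\sum_{\sigma:\sigma(j)=i}w^\varepsilon(\boldsymbol{x}_\sigma;\boldsymbol{\alpha}).$$ The infinite swapping process $\boldsymbol{X}^\varepsilon=(X_1^\varepsilon,\dots,X_K^\varepsilon)$ (with periodic boundary conditions on $D^K$) solves $dX_i^\varepsilon=-\nabla V(X_i^\varepsilon)dt+\sqrt{2\varepsilon}\,(\sum_{j=1}^K\rho_{ij}^\varepsilon(\boldsymbol{X}^\varepsilon;\boldsymbol{\alpha})/\alpha_j)^{1/2}dW_i$, $i=1,\dots,K$, with $W_1,\dots,W_K$ independent Wiener processes. It satisfies a uniform large deviation principle if for each $T\in(0,\infty)$ there is a rate function $I_T\ge0$ on path space over $[0,T]$ such that, with $I_{T,\boldsymbol{x}}(\phi)=I_T(\phi)$ if $\phi(0)=\boldsymbol{x}$ and $+\infty$ otherwise, $\bigcup_{\boldsymbol{x}}\{I_{T,\boldsymbol{x}}\le N\}$ is compact for all $N<\infty$, and for every bounded continuous $F$ on path space $\sup_{\boldsymbol{x}}|\varepsilon\log E_{\boldsymbol{x}}e^{-F(\boldsymbol{X}^\varepsilon)/\varepsilon}+\inf_\phi[I_{T,\boldsymbol{x}}(\phi)+F(\phi)]|\to0$ as $\varepsilon\to0$. *)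

(* Defs.v *)
From HB Require Import structures.
From mathcomp Require Import all_boot all_order all_fingroup all_algebra.
From mathcomp Require Import generic_quotient.
From mathcomp Require Import all_classical all_reals all_analysis.
Set Implicit Arguments.
Unset Strict Implicit.
Unset Printing Implicit Defensive.
Import Order.TTheory GRing.Theory Num.Theory.
Import numFieldNormedType.Exports.
Local Open Scope classical_set_scope.
Local Open Scope ring_scope.
Local Open Scope quotient_scope.

(* R^n is 'rV[R]_n, a vector x having the coordinates x 0 i for i : 'I_n, and
   Sigma_n is 'S_n; the first and last indices of 'I_n.+1 are ord0, ord_max. *)

Section potential.
Context {R : realType}.
Implicit Types (V : R -> R) (a b : R) (A : set R).

Definition C2 V :=
  [/\ forall x, derivable V x 1, forall x, derivable (derive1 V) x 1
    & continuous (derive1 (derive1 V))].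

(* V is the periodic extension of the potential given on D = [a, b].  Local
   extrema are counted in the interior of D: as V > hL = V 0 on the boundary of
   D, the maximum of V over D is attained away from 0, so that with the end
   points included 0 could not be the only local maximum. *)
Record double_well V a b (xL xR hL hR : R) : Prop := DoubleWell {
  dw_interval : a < b ;
  dw_periodic : periodic V (b - a) ;
  dw_C2 : C2 V ;
  dw_bounded : exists M, forall x, `|V x| <= M ;
  dw_min : [set x | a < x < b /\ (\forall y \near x, V x <= V y)] =
           [set xL; xR] ;
  dw_max : [set x | a < x < b /\ (\forall y \near x, V y <= V x)] =
           [set 0] ;
  dw_order : xL < 0 < xR ;
  dw_lt : V xL < V xR ;
  dw_xL : V xL = 0 ;
  dw_0 : V 0 = hL ;
  dw_xR : V xR = hL - hR ;
  dw_xR_gt0 : 0 < hL - hR ;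
  dw_boundary : hL < inf (V @` [set a; b])
}.

Definition Vinf V A : R := inf (V @` A).

End potential.

Section rates.
Context {R : realType} {n : nat}.
Implicit Types (V : R -> R) (A : set R) (al : 'rV[R]_n.+1).

Definition Delta : set 'rV[R]_n.+1 :=
  [set al | [/\ al 0 ord0 = 1,
                forall i j : 'I_n.+1, (i <= j)%N -> al 0 j <= al 0 i
              & 0 < al 0 ord_max]].

Definition weighted V al (x : 'rV[R]_n.+1) : R := \sum_l al 0 l * V (x 0 l).

(* x_sigma = (x_(sigma 1), ..., x_(sigma n)) is col_perm sigma x. *)
Definition min_perm V al x : R :=
  \big[Num.min/weighted V al x]_(s : 'S_n.+1) weighted V al (col_perm s x).

Definition rhat1 V A al : R :=
  inf [set 2 * weighted V al x - min_perm V al x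
      | x in [set x : 'rV[R]_n.+1 | A (x 0 ord0)]].

Definition rhat3 V A (hL : R) al : R := 2 * Vinf V A - al 0 ord_max * hL.

Definition swap_weight V (eps : R) al (x : 'rV[R]_n.+1) : R :=
  expR (- (eps^-1 * weighted V al x)) /
  \sum_(s : 'S_n.+1) expR (- (eps^-1 * weighted V al (col_perm s x))).

Definition rho V eps al x (i j : 'I_n.+1) : R :=
  \sum_(s : 'S_n.+1 | s j == i) swap_weight V eps al (col_perm s x).

Definition diffusion V eps al x (i : 'I_n.+1) : R :=
  Num.sqrt (2 * eps) * Num.sqrt (\sum_j rho V eps al x i j / al 0 j).

End rates.

Section stochastic.
Context {R : realType}.

Definition filtration d (Om : measurableType d) (F : R -> set (set Om)) :=
  [/\ forall t, 0 <= t -> sigma_algebra setT (F t),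
      forall t, 0 <= t -> F t `<=` measurable
    & forall s t, 0 <= s -> s <= t -> F s `<=` F t].

Definition adapted n d (Om : measurableType d) (F : R -> set (set Om))
    (X : R -> Om -> 'rV[R]_n) :=
  forall t i (B : set R), 0 <= t -> measurable B ->
    F t ((fun om => X t om 0 i) @^-1` B).

(* The last clause says at once that the increment over [s, t] is independent
   of F s, that its coordinates are independent and that each of them is
   normal, with variance t - s (normal_prob takes the standard deviation). *)
Definition brownian n d (Om : measurableType d) (P : probability Om R)
    (F : R -> set (set Om)) (W : R -> Om -> 'rV[R]_n) :=
  [/\ adapted F W,
      forall om, W 0 om = 0,
      forall om, {within `[0, +oo[, continuous (W ^~ om)}
    & forall s t (E : set Om) (B : 'I_n -> set R), 0 <= s -> s < t -> F s E ->
        (forall i, measurable (B i)) ->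
        P (E `&` [set om | forall i, B i (W t om 0 i - W s om 0 i)]) =
        (P E * \prod_(i < n) normal_prob 0 (Num.sqrt (t - s)) (B i))%E].

(* For an adapted H with continuous paths, the Ito integral of H with respect
   to the Brownian motion W over [0, t] is the limit in probability of the
   left-point Riemann sums; Y is that integral. *)
Definition is_ito_integral d (Om : measurableType d) (P : probability Om R)
    (H W : R -> Om -> R) (t : R) (Y : Om -> R) :=
  let tau (m i : nat) : R := t * (i%:R / m%:R) in
  forall delta, 0 < delta ->
    P [set om | delta <= `| \sum_(i < m.+1) H (tau m.+1 i) om *
                  (W (tau m.+1 i.+1) om - W (tau m.+1 i) om) - Y om |]
      @[m --> \oo] --> 0%E.

Record process (n : nat) := Process {
  pr_disp : measure_display ;
  pr_space : measurableType pr_disp ;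
  pr_proba : probability pr_space R ;
  pr_traj :> R -> pr_space -> 'rV[R]_n ;
  pr_cont : forall om, {within `[0, +oo[, continuous (pr_traj ^~ om)}
}.

(* X is a (weak) solution started at x of the equation
   dX_i = - V'(X_i) dt + diffusion_i(X) dW_i. *)
Definition infinite_swapping n (V : R -> R) (al : 'rV[R]_n.+1) (eps : R)
    (x : 'rV[R]_n.+1) (X : process n.+1) :=
  exists (F : R -> set (set (pr_space X)))
         (W : R -> pr_space X -> 'rV[R]_n.+1),
  [/\ filtration F, brownian (pr_proba X) F W, adapted F X,
      forall om, X 0 om = x
    & forall t i, 0 <= t ->
        is_ito_integral (pr_proba X)
          (fun s om => diffusion V eps al (X s om) i)
          (fun s om => W s om 0 i) t
          (fun om => X t om 0 i - X 0 om 0 i +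
             \int[lebesgue_measure]_(s in `[0, t]) derive1 V (X s om 0 i))].

End stochastic.

(* The cube [a, b]^n with periodic boundary conditions is the quotient of R^n
   by the lattice of period p = b - a. *)
Section torus.
Context {R : realType} (n : nat) (p : R).

Let lattice_rel (x y : 'rV[R]_n) : bool :=
  `[< exists m : 'rV[int]_n, y = x + p *: map_mx intr m >].

Local Lemma lattice_refl : reflexive lattice_rel.
Proof. by move=> x; apply/asboolP; exists 0; rewrite raddf0 scaler0 addr0. Qed.

Local Lemma lattice_sym : symmetric lattice_rel.
Proof.
suff s x y : lattice_rel x y -> lattice_rel y x.
  by move=> x y; apply/idP/idP; exact: s.
move=> /asboolP[m ->]; apply/asboolP; exists (- m).
by rewrite raddfN scalerN addrK.
Qed.

Local Lemma lattice_trans : transitive lattice_rel.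
Proof.
move=> y x z /asboolP[m ->] /asboolP[m' ->]; apply/asboolP; exists (m + m').
by rewrite raddfD scalerDr addrA.
Qed.

Definition lattice := EquivRel _ lattice_refl lattice_sym lattice_trans.

Definition torus := quotient_topology {eq_quot lattice}.

HB.instance Definition _ := Topological.on torus.
HB.instance Definition _ := Quotient.on torus.

Definition to_torus : 'rV[R]_n -> torus := \pi_torus.

Lemma to_torus_continuous : continuous to_torus.
Proof. exact: pi_continuous. Qed.

End torus.

Section large_deviations.
Import ArrowAsCompactOpen.
Context {R : realType} (n : nat) (a b : R).

(* C([0, T]; torus); the compact-open topology is that of uniform convergence. *)
Definition path_space (T : R) : topologicalType :=
  continuousType (`[0, T]%classic : set R) (torus n (b - a)).

Lemma path_of_continuous (T : R) (f : R -> 'rV[R]_n) :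
  {within `[0, +oo[, continuous f} ->
  continuous (@to_torus R n (b - a) \o sigL `[0, T]%classic f).
Proof.
move=> cf; have /subspace_sigL_continuousP cT : {within `[0, T], continuous f}.
  by apply: continuous_subspaceW cf => t /=; rewrite !in_itv/= => /andP[->].
by move=> t; apply: continuous_comp; [exact: cT | exact: to_torus_continuous].
Qed.

Definition path_of (T : R) (X : process n) (om : pr_space X) :
  path_space T := mkcts (@path_of_continuous T _ (@pr_cont _ _ X om)).

Definition starts_at (T : R) (x : 'rV[R]_n) (phi : path_space T) :=
  forall t : (`[0, T]%classic : set R), set_val t = 0 ->
    phi t = to_torus (b - a) x.

Definition rate_from (T : R) (I : path_space T -> \bar R) x phi : \bar R :=
  if `[< starts_at x phi >] then I phi else +oo%E.

Definition cube : set 'rV[R]_n := [set x | forall i, a <= x 0 i <= b].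

(* X eps x is the process with parameter eps started at x. *)
Definition uniform_LDP (X : R -> 'rV[R]_n -> process n) :=
  forall T : R, 0 < T ->
  exists I : path_space T -> \bar R,
  [/\ forall phi, (0 <= I phi)%E,
      forall N : R, compact
        (\bigcup_(x in cube) [set phi | (rate_from I x phi <= N%:E)%E])
    & forall F : path_space T -> R,
        continuous F -> (exists M, forall phi, `|F phi| <= M) ->
        ereal_sup [set
            `| (eps * ln (fine ('E_(pr_proba (X eps x))
                    [fun om => expR (- (F (path_of T om) / eps))])%E))%:E
               + ereal_inf (range (fun phi =>
                    rate_from I x phi + (F phi)%:E)) |%E
          | x in cube] @[eps --> 0^'+] --> 0%E].

End large_deviations.

(* Main.v *)
Require Import Defs.
From HB Require Import structures.
From mathcomp Require Import all_boot all_order all_fingroup all_algebra.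
From mathcomp Require Import all_classical all_reals all_analysis.
From mathcomp Require Import ring lra.
Set Implicit Arguments.
Unset Strict Implicit.
Unset Printing Implicit Defensive.
Import Order.TTheory GRing.Theory Num.Theory.
Import numFieldNormedType.Exports.
Local Open Scope classical_set_scope.
Local Open Scope ring_scope.

(** With m = V(A), M = max(m, hL) and q = (1/2)^(K-2), both cases say that
    the supremum is 2m - q (M / (m + M)) m, attained at the geometric
    temperatures 1, 1/2, ..., q whose last one is replaced by be q, where
    be = m / (m + M): if m >= hL then be = 1/2, and otherwise M = hL.
    This is finite-dimensional optimization: the potential enters through
    V >= 0, V(xL) = 0 and the fact that m > 0 is attained on A.

    Lower bound (rhat1_halving_ge).  Bounding the minimum over permutations by
    one permutation s gives
      2 sum_l al_l V(x_l) - min >= sum_l (2 al_l - al_(s l)) V(x_l).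
    For the cyclic shift l -> l - 1 the coefficients with 0 < l < K - 1 vanish,
    since 2 al_l = al_(l-1).  The first and the last remain; the last one,
    (2 be - 1) q, is nonpositive.  If V(x_last) <= V(x_0), this permutation
    is good enough; otherwise the one obtained by exchanging the two highest
    indices in the image makes the last coefficient nonnegative.  In both
    cases the sum is at least (2 - q (1 - be)) V(x_0), and V(x_0) >= m.  The
    number be is the one at which this bound equals 2m - be q M.

    Upper bound (rates_le).  Fix al and let r be the smaller rate.  Put a
    minimizer of V over A at the index 0 and at the indices above j, and xL at
    the others: since al is nonincreasing, the cheapest permutation moves the
    minimizers to the last indices, so r <= m (2 + T_(j+1) - al_j) with T the
    tail sums of al (rhat1_le_tail).  Putting c = 2m - r, this says
    m al_j <= c + m T_(j+1), that is m T_j + c <= 2 (m T_(j+1) + c), while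
    rhat3, or the case of the last index j, gives M al_last <= c.  Going from
    the last index down to 0, where al_0 = 1, yields m <= c (m + M) / (q M),
    which is the claimed bound on r. *)

(** * The potential *)

Section potential.
Context {R : realType}.
Variables (V : R -> R) (a b xL xR hL hR : R).
Hypothesis hV : double_well V a b xL xR hL hR.

Lemma double_well_continuous : continuous V.
Proof.
have [dV _ _] := dw_C2 hV.
by move=> x; apply: differentiable_continuous; apply/derivable1_diffP.
Qed.

Lemma double_well_boundary x : x = a \/ x = b -> hL < V x.
Proof.
move=> xab; apply: lt_le_trans (dw_boundary hV) _.
apply: ge_inf; last by exists x.
have [M VM] := dw_bounded hV.
by exists (- M) => _ [u _ <-]; have := VM u; rewrite ler_norml => /andP[].
Qed.

Lemma double_well_zero_in : a < 0 < b.
Proof.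
have : [set x | a < x < b /\ \forall y \near x, V y <= V x] 0.
  by rewrite (dw_max hV).
by case.
Qed.

Lemma itv_endpoint_or_interior x : a <= x <= b -> (x = a \/ x = b) \/ a < x < b.
Proof.
move=> /andP[]; rewrite 2!le_eqVlt => /orP[/eqP->|ax]; first by do 2!left.
by move=> /orP[/eqP->|xb]; [left; right|right; rewrite ax].
Qed.

(** A minimizer over [a, b] cannot be an end point, where V exceeds V 0, so it
    is one of the two local minima; at both of them V is nonnegative. *)
Lemma double_well_ge0_itv x : a <= x <= b -> 0 <= V x.
Proof.
move=> xab.
have cV : {within `[a, b], continuous V}.
  by apply: continuous_subspaceT; exact: double_well_continuous.
have [c] := EVT_min (ltW (dw_interval hV)) cV.
rewrite in_itv/= => cab minV.
have Vcx : V c <= V x by apply: minV; rewrite in_itv.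
have [/double_well_boundary hc|ci] := itv_endpoint_or_interior cab.
  have /andP[a0 b0] := double_well_zero_in.
  have : V c <= V 0 by apply: minV; rewrite in_itv/= !ltW.
  by rewrite (dw_0 hV) leNgt hc.
have : [set x | a < x < b /\ \forall y \near x, V x <= V y] c.
  split=> //; have oab : c \in `]a, b[%R by rewrite in_itv.
  apply: filterS (near_in_itvoo oab) => y yab.
  by apply: minV; exact: subset_itv_oo_cc yab.
rewrite (dw_min hV) => -[cE|cE]; move: Vcx; rewrite cE.
  by rewrite (dw_xL hV).
by rewrite (dw_xR hV); apply: le_trans; rewrite ltW// (dw_xR_gt0 hV).
Qed.

Lemma double_well_ge0 x : 0 <= V x.
Proof.
have p0 : 0 < b - a by rewrite subr_gt0 (dw_interval hV).
have perZ (i : int) u : V (u + (b - a) *~ i) = V u.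
  case: i => n; first exact: (periodicn (dw_periodic hV)).
  by rewrite NegzE mulrNz -[LHS](periodicn (dw_periodic hV) n.+1) subrK.
rewrite -(perZ (- Num.floor ((x - a) / (b - a)))) mulrNz.
apply: double_well_ge0_itv; set i := Num.floor _.
have /andP[] := floor_itv ((x - a) / (b - a)).
rewrite -/i ler_pdivlMr// ltr_pdivrMr// intrD mulrDl mul1r -mulrzl; lra.
Qed.

(** A zero of V is a global minimum, hence a local one; this is how the
    hypothesis that A avoids xL makes V positive on A. *)
Lemma double_well_zero x : a <= x <= b -> V x = 0 -> x = xL.
Proof.
move=> xab Vx; have [/double_well_boundary|xi] := itv_endpoint_or_interior xab.
  by rewrite Vx ltNge -(dw_0 hV) double_well_ge0.
have : [set x | a < x < b /\ \forall y \near x, V x <= V y] x.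
  by split=> //; apply: filterE => u; rewrite Vx double_well_ge0.
rewrite (dw_min hV) => -[//|xE]; have := dw_xR_gt0 hV.
by rewrite -(dw_xR hV) -xE Vx ltxx.
Qed.

Lemma Vinf_attained A : A !=set0 -> closed A -> A `<=` `[a, b] ->
  exists2 y, A y & V y = Vinf V A.
Proof.
move=> A0 clA Aab.
have cA : compact A.
  by apply: subclosed_compact Aab => //; exact: segment_compact.
have [] := compact_EVT_min A0 cA (continuous_subspaceT double_well_continuous).
move=> y /set_mem Ay ymin; exists y => //; apply/eqP; rewrite eq_le.
have lbVA : lbound (V @` A) (V y).
  by move=> _ [x Ax <-]; apply: ymin; exact/mem_set.
rewrite lb_le_inf//=; first by apply: ge_inf; [exists (V y)|exists y].
by exists (V y); exists y.
Qed.

End potential.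

(** * The rates for arbitrary temperatures *)

Section rates.
Context {R : realType}.
Implicit Types (V : R -> R) (A : set R).

Section any_dimension.
Context {n : nat}.
Implicit Types (al x : 'rV[R]_n.+1).

Lemma weighted_col_perm V al x (s : 'S_n.+1) :
  weighted V al (col_perm s x) = \sum_l al 0 ((s^-1)%g l) * V (x 0 l).
Proof.
rewrite /weighted (reindex_inj (@perm_inj _ (s^-1)%g)).
by apply: eq_bigr => l _; rewrite mxE permKV.
Qed.

Lemma min_perm_le V al x (s : 'S_n.+1) :
  min_perm V al x <= \sum_l al 0 (s l) * V (x 0 l).
Proof.
apply: le_trans (bigmin_le _ (s^-1)%g _) _.
by rewrite weighted_col_perm invgK.
Qed.

Lemma swap_cost_ge V al x (s : 'S_n.+1) :
  \sum_l (2 * al 0 l - al 0 (s l)) * V (x 0 l) <=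
  2 * weighted V al x - min_perm V al x.
Proof.
have -> : \sum_l (2 * al 0 l - al 0 (s l)) * V (x 0 l) =
          2 * weighted V al x - \sum_l al 0 (s l) * V (x 0 l).
  rewrite /weighted mulr_sumr -sumrB; apply: eq_bigr => l _; ring.
by rewrite lerD2l lerN2 min_perm_le.
Qed.

Lemma Delta_gt0 al i : Delta al -> 0 < al 0 i.
Proof.
by case=> _ dec al0; apply: lt_le_trans al0 (dec _ _ _); exact: leq_ord.
Qed.

(** The identity permutation bounds the cost below by
    weighted V al x >= 0, so that the infimum defining rhat1 is a lower
    bound. *)
Lemma rhat1_le V A al x : (forall u, 0 <= V u) -> Delta al -> A (x 0 ord0) ->
  rhat1 V A al <= 2 * weighted V al x - min_perm V al x.
Proof.
move=> V0 al0 Ax; apply: ge_inf; last by exists x.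
exists 0 => _ [u _ <-]; apply: le_trans (swap_cost_ge V al u 1%g).
apply: sumr_ge0 => l _; rewrite perm1; apply: mulr_ge0 => //.
have := Delta_gt0 l al0; lra.
Qed.

Lemma rhat1_ge V A al c : A !=set0 ->
  (forall x, A (x 0 ord0) -> c <= 2 * weighted V al x - min_perm V al x) ->
  c <= rhat1 V A al.
Proof.
move=> [u Au] cx; apply: lb_le_inf; last by move=> _ [x Ax <-]; exact: cx.
by exists (2 * weighted V al (const_mx u) - min_perm V al (const_mx u));
  exists (const_mx u) => //=; rewrite mxE.
Qed.

Definition tail al (j : nat) : R := \sum_(l < n.+1 | (j <= l)%N) al 0 l.

Lemma tail_ord al (j : 'I_n.+1) : tail al j = al 0 j + tail al j.+1.
Proof.
rewrite /tail (bigD1 j)//=; congr (_ + _); apply: eq_bigl => l.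
by rewrite ltn_neqAle andbC eq_sym.
Qed.

Lemma tail_oversize al : tail al n.+1 = 0.
Proof. by rewrite /tail big1// => l; rewrite leqNgt ltn_ord. Qed.

(** A set of indices as large as a tail has at least its al-weight: replacing
    al_l by al_l - al_j changes both sums by the same amount, and then every
    term of the tail is nonpositive, every other term nonnegative. *)
Lemma tail_le_perm al (j : 'I_n.+1) (s : 'S_n.+1) :
  (forall i l : 'I_n.+1, (i <= l)%N -> al 0 l <= al 0 i) ->
  tail al j <= \sum_(l | (j <= s l)%N) al 0 l.
Proof.
move=> dec; rewrite /tail [leLHS]big_mkcond [leRHS]big_mkcond -subr_ge0 -sumrB.
pose ind l : R := (j <= s l)%N%:R - (j <= l)%N%:R.
have ind0 : \sum_l ind l = 0.
  by rewrite sumrB [X in _ - X](reindex_inj (@perm_inj _ s)) subrr.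
have mul_ind0 : \sum_l al 0 j * ind l = 0 by rewrite -mulr_sumr ind0 mulr0.
rewrite -[leRHS]subr0 -[X in _ - X]mul_ind0 -sumrB.
apply: sumr_ge0 => l _; rewrite /ind.
have [jl|/ltnW /dec lj] := leqP j l; first have := dec _ _ jl.
all: by case: (j <= s l)%N => /=; rewrite ?mulr1n ?mulr0n; lra.
Qed.

(** The trial configuration has y at the index 0 and at the indices above j, z
    elsewhere.  That set of indices is the tail from j, transported by the
    transposition of 0 and j, so each permuted configuration has the weight
    of the image of a tail under a permutation. *)
Lemma rhat1_le_tail V A al (y z : R) (j : 'I_n.+1) :
  (forall u, 0 <= V u) -> Delta al -> A y -> V z = 0 ->
  rhat1 V A al <= V y * (2 + tail al j.+1 - al 0 j).
Proof.
move=> V0 alD Ay Vz; have [al1 dec _] := alD.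
pose p : 'S_n.+1 := tperm ord0 j.
pose x : 'rV[R]_n.+1 := \row_l if (j <= p l)%N then y else z.
have Vx l : V (x 0 l) = if (j <= p l)%N then V y else 0.
  by rewrite mxE; case: ifP.
have x0 : A (x 0 ord0) by rewrite mxE tpermL leqnn.
have sumV (s : 'S_n.+1) : weighted V al (col_perm s x) =
    V y * \sum_(l | (j <= (s * p)%g l)%N) al 0 l.
  rewrite /weighted mulr_sumr [RHS]big_mkcond/=; apply: eq_bigr => l _.
  by rewrite mxE Vx permM; case: ifP => _; rewrite ?mulr0 1?mulrC.
have wx : weighted V al x = V y * (1 + tail al j.+1).
  have := sumV 1%g; rewrite col_perm1 mul1g => ->; congr (_ * _).
  rewrite (reindex_inj (@perm_inj _ p)) (bigD1 j)/= ?tpermK ?leqnn//.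
  rewrite tpermR al1; congr (_ + _); apply: eq_big => [l|l /andP[]].
    by rewrite tpermK ltn_neqAle andbC eq_sym.
  rewrite tpermK => jl lj; rewrite tpermD ?[_ == l]eq_sym//.
  by apply: contraNneq lj => l0; move: jl; rewrite l0 leqn0 => /eqP j0;
    apply/eqP/val_inj.
have minx : V y * tail al j <= min_perm V al x.
  apply/bigmin_geP; split=> [|s _]; last first.
    by rewrite sumV ler_wpM2l// tail_le_perm.
  by rewrite -[x]col_perm1 sumV ler_wpM2l// tail_le_perm.
apply: le_trans (rhat1_le V0 alD x0) _.
rewrite wx; move: minx; rewrite tail_ord; lra.
Qed.

End any_dimension.

(** * Halving temperatures and the optimal value *)

(** The recursion reads T j + c <= 2 (T j.+1 + c) when T is a tail sum, the
    term T j - T j.+1 being at most c + T j.+1. *)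
Lemma tail_growth (T : nat -> R) (c d : R) (k : nat) : T k.+1 <= d ->
  (forall j, (0 < j <= k)%N -> T j <= c + 2 * T j.+1) ->
  T 1%N + c <= 2 ^+ k * (c + d).
Proof.
move=> Tk Tj; suff H i : (i <= k)%N -> T (k.+1 - i)%N + c <= 2 ^+ i * (c + d).
  by have := H k (leqnn _); rewrite subSnn.
elim: i => [_|i IH ik]; first by rewrite subn0 expr0; lra.
have := Tj (k - i)%N; rewrite subn_gt0 ik leq_subr => /(_ isT).
move: (IH (ltnW ik)); rewrite subSn ?(ltnW ik)// subSS exprS; lra.
Qed.

Section at_least_two.
Context {k : nat}.

(** The last temperature stays free: be = 1/2 continues the geometric sequence,
    a smaller be trades rhat1 for rhat3. *)
Definition halving_temps (be : R) : 'rV[R]_k.+2 :=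
  \row_l (if l == ord_max then be * (1 / 2) ^+ k else (1 / 2) ^+ l).

Lemma halving_temps_Delta be : 0 < be <= 1 -> Delta (halving_temps be).
Proof.
move=> /andP[be0 be1]; split=> [|i j ij|].
- by rewrite mxE expr0.
- have half (p q : nat) : (p <= q)%N -> (1 / 2 : R) ^+ q <= (1 / 2) ^+ p.
    by move=> pq; apply: ler_wiXn2l => //; lra.
  rewrite !mxE; case: eqP => [jm|/eqP jm]; case: eqP => [im|/eqP im] //.
  + rewrite -[leRHS]mul1r; apply: ler_pM => //; first exact: ltW.
    by apply: half; rewrite -ltnS ltn_neqAle leq_ord andbT.
  + by move: jm; rewrite -val_eqE eqn_leq leq_ord -im ij.
  + exact: half.
- by rewrite mxE eqxx mulr_gt0// exprn_gt0//; lra.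
Qed.

Definition cyclic_shift : 'S_k.+2 := perm (@ord_pred_inj k.+2).

Lemma cyclic_shift0 : cyclic_shift ord0 = ord_max.
Proof. by apply/val_inj; rewrite permE/= modn_small. Qed.

Lemma cyclic_shift_gt0 (l : 'I_k.+2) : l != ord0 ->
  val (cyclic_shift l) = l.-1.
Proof.
case: l => -[//|l] lk _; rewrite permE/= modnDr modn_small//; exact: ltnW.
Qed.

(** The number 2 - q (1 - be), with q = (1/2)^k, is what remains at the index 0
    after the coefficients 2 al_l - al_(s l) at the middle indices cancel. *)
Lemma rhat1_halving_ge V A (m be : R) : A !=set0 ->
  (forall u, A u -> m <= V u) -> 0 <= m -> 0 <= be <= 1 / 2 ->
  (2 - (1 / 2) ^+ k * (1 - be)) * m <= rhat1 V A (halving_temps be).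
Proof.
move=> A0 mA m0 /andP[be0 be1]; apply: rhat1_ge => // x /mA mx.
set q := (1 / 2) ^+ k.
have q0 : 0 <= q by rewrite exprn_ge0//; lra.
have q1 : q <= 1 by rewrite exprn_ile1//; lra.
have qb0 : 0 <= q * (1 - be) by rewrite mulr_ge0//; lra.
have qb1 : q * (1 - be) <= 1 by rewrite mulr_ile1//; lra.
apply: le_trans (_ : (2 - q * (1 - be)) * V (x 0 ord0) <= _).
  by rewrite ler_wpM2l//; lra.
have sum_ends (F : 'I_k.+2 -> R) :
    (forall l : 'I_k.+2, (0 < l < k.+1)%N -> F l = 0) ->
    \sum_l F l = F ord0 + F ord_max.
  move=> F0; rewrite (bigD1 ord0)//= (bigD1 ord_max)//= big1 ?addr0// => l.
  move=> /andP[l0 lm]; apply: F0; rewrite lt0n -val_eqE/= in l0 *.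
  by rewrite l0 -ltnS ltn_neqAle ltn_ord andbT.
have mid_val (l : 'I_k.+2) : (0 < l < k.+1)%N ->
    2 * halving_temps be 0 l = (1 / 2) ^+ l.-1.
  move=> /andP[l0 lk]; rewrite mxE -val_eqE/= ltn_eqF//.
  by rewrite -[in LHS](prednK l0) exprS; lra.
pose c := cyclic_shift.
have mid_shift (l : 'I_k.+2) : (0 < l < k.+1)%N -> (c l < k)%N /\
    halving_temps be 0 (c l) = (1 / 2) ^+ l.-1.
  move=> /andP[l0 lk]; have cl : c l = l.-1 :> nat.
    by apply: cyclic_shift_gt0; rewrite -val_eqE/= -lt0n.
  have clk : (c l < k)%N by rewrite cl prednK.
  by split=> //; rewrite mxE -val_eqE/= ltn_eqF ?cl// -cl ltnW.
have c_max : c ord_max = inord k.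
  by apply/val_inj; rewrite (@cyclic_shift_gt0 ord_max)// [RHS]inordK.
have inord_max : (inord k == ord_max :> 'I_k.+2) = false.
  by rewrite -val_eqE/= inordK// ltn_eqF.
have al0 : halving_temps be 0 ord0 = 1 by rewrite mxE.
have al_k : halving_temps be 0 (inord k) = q by rewrite mxE inord_max inordK.
have al_max : halving_temps be 0 ord_max = be * q by rewrite mxE eqxx.
(* Which end carries the larger value of V tells where the permutation should
   send the largest index: down by one, or to itself. *)
have [Vmax0|V0max] := leP (V (x 0 ord_max)) (V (x 0 ord0)).
  apply: le_trans (swap_cost_ge V _ x c); rewrite sum_ends; last first.
    by move=> l lk; rewrite mid_val// (mid_shift l lk).2 subrr mul0r.
  rewrite c_max cyclic_shift0 al0 al_k al_max -subr_ge0.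
  have -> : (2 * 1 - be * q) * V (x 0 ord0) +
      (2 * (be * q) - q) * V (x 0 ord_max) -
      (2 - q * (1 - be)) * V (x 0 ord0) =
      q * ((1 - 2 * be) * (V (x 0 ord0) - V (x 0 ord_max))) by ring.
  by do 2!apply: mulr_ge0 => //; lra.
apply: le_trans (swap_cost_ge V _ x (c * tperm ord_max (inord k))%g).
rewrite sum_ends; last first.
  move=> l lk; rewrite mid_val//; have [clk al_c] := mid_shift l lk.
  rewrite permM tpermD ?al_c ?subrr ?mul0r//.
    by rewrite -val_eqE/= eq_sym ltn_eqF ?(leq_trans clk).
  by rewrite -val_eqE/= inordK// eq_sym ltn_eqF.
rewrite !permM c_max cyclic_shift0 tpermL tpermR al0 al_k al_max -subr_ge0.
have -> : (2 * 1 - q) * V (x 0 ord0) +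
    (2 * (be * q) - be * q) * V (x 0 ord_max) -
    (2 - q * (1 - be)) * V (x 0 ord0) =
    q * (be * (V (x 0 ord_max) - V (x 0 ord0))) by ring.
by do 2!apply: mulr_ge0 => //; lra.
Qed.

(** The inequalities m al_j <= c + m T_(j+1) and M al_last <= c, chained from
    the last index to the first. *)
Lemma rates_le V A hL (al : 'rV[R]_k.+2) (y z M : R) :
  (forall u, 0 <= V u) -> Delta al ->
  A y -> V y = Vinf V A -> 0 < V y -> V z = 0 -> M = Num.max (V y) hL ->
  Num.min (rhat1 V A al) (rhat3 V A hL al) <=
  2 * V y - (1 / 2) ^+ k * (M / (V y + M)) * V y.
Proof.
move=> V0 alD Ay yinf Vy0 Vz ME.
set r := Num.min _ _; set m := V y.
have r1 (j : 'I_k.+2) : r <= m * (2 + tail al j.+1 - al 0 j).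
  by rewrite (le_trans _ (rhat1_le_tail j V0 alD Ay Vz))// ge_min lexx.
have r3 : r <= 2 * m - al 0 ord_max * hL.
  by rewrite /m yinf ge_min lexx orbT.
have M0 : 0 < M by rewrite ME lt_max Vy0.
(* M is m or hL: the first comes from rhat1 at the last index. *)
have rM : al 0 ord_max * M <= 2 * m - r.
  rewrite ME /Num.max; case: ifP => _; first lra.
  have := r1 ord_max; rewrite tail_oversize -/m; lra.
pose c := 2 * m - r.
have step (j : 'I_k.+2) : m * al 0 j <= c + m * tail al j.+1.
  by have := r1 j; rewrite /c; lra.
have last_le : m * tail al k.+1 <= c * (m / M).
  have := tail_ord al ord_max; rewrite tail_oversize addr0 /= => ->.
  rewrite mulrA ler_pdivlMr// [c * m]mulrC -mulrA ler_wpM2l//; exact: ltW.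
have qE : (1 / 2 : R) ^+ k = (2 ^+ k)^-1 by rewrite div1r exprVn.
have growth : m * tail al 1 + c <= 2 ^+ k * (c + c * (m / M)).
  apply: (tail_growth (T := fun j => m * tail al j)) => // j /andP[j0 jk].
  have jk2 : (j < k.+2)%N by rewrite ltnS ltnW.
  have := step (Ordinal jk2); rewrite (tail_ord al (Ordinal jk2)) /=; lra.
have := step ord0; have [-> _ _] := alD; rewrite mulr1 /= => s0; rewrite qE.
have P0 : 0 < (2 : R) ^+ k by rewrite exprn_gt0.
have mM : 0 < m + M by rewrite addr_gt0.
have : m <= 2 ^+ k * (c + c * (m / M)) by lra.
have -> : 2 ^+ k * (c + c * (m / M)) = c / ((2 ^+ k)^-1 * (M / (m + M))).
  by field; rewrite !lt0r_neq0.
rewrite ler_pdivlMr ?mulr_gt0 ?invr_gt0// /c; lra.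
Qed.

(** At be = m / (m + M) the bound (2 - q (1 - be)) m on rhat1 coincides with
    2 m - be q M, which is at most rhat3. *)
Lemma rates_ge V A hL (m M : R) : A !=set0 -> Vinf V A = m ->
  (forall u, A u -> m <= V u) -> 0 < m -> m <= M -> hL <= M ->
  2 * m - (1 / 2) ^+ k * (M / (m + M)) * m <=
  Num.min (rhat1 V A (halving_temps (m / (m + M))))
          (rhat3 V A hL (halving_temps (m / (m + M)))).
Proof.
move=> A0 infm mA m0 mM0 hM.
have M0 : 0 < M by exact: lt_le_trans m0 mM0.
have mM : 0 < m + M by rewrite addr_gt0.
have q0 : 0 < (1 / 2 : R) ^+ k by rewrite exprn_gt0//; lra.
rewrite le_min; apply/andP; split.
  have be : 0 <= m / (m + M) <= 1 / 2.
    apply/andP; split; first by apply: divr_ge0; exact: ltW.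
    by rewrite ler_pdivrMr//; lra.
  have := rhat1_halving_ge A0 mA (ltW m0) be.
  apply: le_trans; rewrite le_eqVlt; apply/orP; left; apply/eqP.
  by field; rewrite lt0r_neq0.
rewrite /rhat3 infm mxE eqxx lerD2l lerN2.
have -> : (1 / 2) ^+ k * (M / (m + M)) * m =
    m / (m + M) * (1 / 2) ^+ k * M by ring.
by rewrite ler_wpM2l// mulr_ge0 ?divr_ge0 ?ltW.
Qed.

End at_least_two.
End rates.

Lemma sup_attained (R : realType) (T : Type) (S : set T) (f : T -> R) (x : T)
    (c : R) : S x -> (forall y, S y -> f y <= c) -> c <= f x ->
  sup (f @` S) = c /\ f x = sup (f @` S).
Proof.
move=> Sx fc cf; have fx : f x = c by apply/eqP; rewrite eq_le cf fc.
suff -> : sup (f @` S) = c by [].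
apply/eqP; rewrite eq_le ge_sup/=; last 2 first.
- by exists (f x); exists x.
- by move=> _ [y Sy <-]; exact: fc.
by rewrite -fx; apply: ub_le_sup; [exists c => _ [y Sy <-]; exact: fc|exists x].
Qed.

(* The number of temperatures is K = k.+2, so K - 1 = k.+1 and K - 2 = k. *)
Theorem theorem4p6 (R : realType) (k : nat) (V : R -> R)
    (a b xL xR hL hR : R) (A : set R)
    (X : 'rV[R]_k.+2 -> R -> 'rV[R]_k.+2 -> process k.+2)
    (hV : double_well V a b xL xR hL hR)
    (hX : forall al, Delta al -> forall eps, 0 < eps ->
       forall x, cube a b x -> infinite_swapping V al eps x (X al eps x))
    (hLDP : forall al, Delta al -> uniform_LDP a b (X al))
    (hA0 : A !=set0) (hAclosed : closed A)
    (hAsub : A `<=` `[a, b] `&` `]-oo, 0]) (hAxL : ~ A xL) :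
  let VA := Vinf V A in
  let r (al : 'rV[R]_k.+2) := Num.min (rhat1 V A al) (rhat3 V A hL al) in
  (hL <= VA ->
     let al_opt : 'rV[R]_k.+2 := \row_l (1 / 2) ^+ l in
     [/\ sup (r @` Delta) = 2 * VA - (1 / 2) ^+ k.+1 * VA,
         Delta al_opt
       & r al_opt = sup (r @` Delta)]) /\
  (VA <= hL ->
     let al_opt : 'rV[R]_k.+2 := \row_l
       (if l == ord_max then VA / (VA + hL) * (1 / 2) ^+ k
        else (1 / 2) ^+ l) in
     [/\ sup (r @` Delta) =
           2 * VA - (1 / 2) ^+ k * (hL / (VA + hL)) * VA,
         Delta al_opt
       & r al_opt = sup (r @` Delta)]).
Proof.
move=> VA r.
have V0 := double_well_ge0 hV.
have Aab : A `<=` `[a, b] by move=> x /hAsub[].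
have [y Ay Vy] := Vinf_attained hV hA0 hAclosed Aab.
have yab : a <= y <= b by have := Aab _ Ay; rewrite /= in_itv.
have Vy0 : 0 < V y.
  rewrite lt_neqAle V0 andbT; apply/eqP => Vy0.
  by apply: hAxL; rewrite -(double_well_zero hV yab (esym Vy0)).
have VAle u : A u -> VA <= V u.
  by move=> Au; apply: ge_inf; [exists 0 => _ [x _ <-]|exists u].
have half_share (u : R) : 0 < u -> u / (u + u) = 1 / 2.
  by move=> u0; field; apply: lt0r_neq0; exact: addr_gt0.
pose M := Num.max VA hL; pose al : 'rV[R]_k.+2 := halving_temps (VA / (VA + M)).
have VA0 : 0 < VA by rewrite /VA -Vy.
have M0 : 0 < M by rewrite lt_max VA0.
have alD : Delta al.
  apply: halving_temps_Delta; rewrite divr_gt0 ?addr_gt0//=.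
  by rewrite ler_pdivrMr ?addr_gt0// mul1r lerDl ltW.
have [supE optE] : sup (r @` Delta) =
      2 * VA - (1 / 2) ^+ k * (M / (VA + M)) * VA /\ r al = sup (r @` Delta).
  apply: sup_attained => // [al' al'D|].
    have := rates_le V0 al'D Ay Vy Vy0 (dw_xL hV) (erefl (Num.max (V y) hL)).
    by rewrite /r /M /VA -Vy.
  by apply: rates_ge => //; rewrite le_max lexx ?orbT.
split=> [hLA|hAL] al_opt.
  have ME : M = VA by rewrite /M; apply/max_idPl.
  have alE : al = al_opt.
    apply/rowP => l; rewrite !mxE ME; case: eqP => [->|//].
    by rewrite (half_share _ VA0) exprS.
  split; [|by rewrite -alE|by rewrite -alE].
  by rewrite supE ME (half_share _ VA0) exprSr.
have ME : M = hL by rewrite /M; apply/max_idPr.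
have alE : al = al_opt by apply/rowP => l; rewrite !mxE ME.
by split; [rewrite supE ME|rewrite -alE|rewrite -alE].
Qed.
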